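(* Let $n\ge 1$, and let $U^{-1}$ denote the weight matrix of the $U$-type network of order $n$ in which a rise edge from $(k,y-1)$ to $(k+1,y)$ (with $y\ne 0$) has weight $-t_{k,y}$ and every horizontal edge has weight $1$. Then for all $0\le i,j\le n$, $$U^{-1}[i,j]=(-1)^{i-j}\sum_{\alpha\in Q^{SD}_{j,i}}\ \prod_{s=i}^{j-1}t_{\alpha_{j-s},s+1}.$$
   Context: Let $t_{a,b}$ be real scalars for integers $0\le a<b$. Rows and columns of $(n+1)\times(n+1)$ matrices are indexed by $0,\dots,n$. Paths of the $U$-type network of order $n$ from source $i$ to sink $j$: $\mathcal{P}^{U_n}_{i,j}$ is the set of sequences of points $(k,y_k)$, $k=0,\dots,n$, with $y_k\in\{0,\dots,n\}$, $y_0=i$, $y_n=j$, $y_{k+1}\in\{y_k,y_k+1\}$ for $k<n$, and such that $y_{k+1}=y_k+1$ implies $y_k\ge k$. The weight $\omega(p)$ of a path is the product of the weights of its edges (steps), and the weight matrix is the $(n+1)\times(n+1)$ matrix whose $(i,j)$ entry is $\sum_{p\in\mathcal{P}^{U_n}_{i,j}}\omega(p)$. Here $U^{-1}$ is simply the name of the weight matrix defined in the claim. For $a>b$, $Q^{SD}_{a,b}$ is the set of strictly decreasing integer sequences $\alpha=(\alpha_1,\dots,\alpha_{a-b})$ of length $a-b$ with $0\le\alpha_r\le a-r$ for every $r$. Also $Q^{SD}_{a,a}=\{\varepsilon\}$ where $\varepsilon$ is the empty sequence, and $Q^{SD}_{a,b}=\emptyset$ for $a<b$. Empty products equal $1$ and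 empty sums equal $0$. *)

(* Defs.v *)
From HB Require Import structures.
From mathcomp Require Import all_boot all_order all_algebra.
From mathcomp Require Import reals.

Set Implicit Arguments.
Unset Strict Implicit.
Unset Printing Implicit Defensive.

Import GRing.Theory.
Local Open Scope ring_scope.

Section UNetwork.
Variable n : nat.

Definition Ustep (k y y' : nat) : bool :=
  ((y' == y) || (y' == y.+1)) && ((y' == y.+1) ==> (k <= y)%N).

(* A path (k, y_k), 0 <= k <= n, is the finite function k |-> y_k.  For
   k : 'I_n the two injections into 'I_n.+1 used below are k and k + 1. *)
Definition Upaths (i j : 'I_n.+1) : {set {ffun 'I_n.+1 -> 'I_n.+1}} :=
  [set y : {ffun 'I_n.+1 -> 'I_n.+1} | [&& y ord0 == i, y ord_max == j &
    [forall k : 'I_n, Ustep k (y (widen_ord (leqnSn n) k)) (y (lift ord0 k))]]].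

(* w k y y' is the weight of the edge from (k, y) to (k + 1, y'). *)
Definition path_weight (R : realType) (w : nat -> nat -> nat -> R)
    (y : {ffun 'I_n.+1 -> 'I_n.+1}) : R :=
  \prod_(k < n) w k (y (widen_ord (leqnSn n) k)) (y (lift ord0 k)).

Definition Uweight_mx (R : realType) (w : nat -> nat -> nat -> R) : 'M[R]_n.+1 :=
  \matrix_(i, j) \sum_(y in Upaths i j) path_weight w y.

End UNetwork.

(* Only the values t a b with a < b matter: a rise into height y' at time k
   in a path satisfies k <= y' - 1. *)
Definition Uinv_edge (R : realType) (t : nat -> nat -> R) (k y y' : nat) : R :=
  if y' == y then 1 else - t k y'.

Definition Uinv (R : realType) (t : nat -> nat -> R) (n : nat) : 'M[R]_n.+1 :=
  Uweight_mx n (Uinv_edge t).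

(* The sequence (alpha_1, ..., alpha_(a-b)) is a tuple, with alpha_r stored at
   position r - 1.  The bounds alpha_r <= a - r with r >= 1 put every entry in
   'I_a.  Subtraction truncates, hence the explicit condition b <= a, which
   makes the set empty when a < b. *)
Definition QSD (a b : nat) : {set (a - b).-tuple 'I_a} :=
  [set alpha : (a - b).-tuple 'I_a |
    [&& (b <= a)%N, sorted gtn (map val alpha) &
      [forall r : 'I_(a - b), (tnth alpha r <= a - r.+1)%N]]].

(* alpha_r, with r counted from 1. *)
Definition entry (m a : nat) (alpha : m.-tuple 'I_a) (r : nat) : nat :=
  nth 0%N (map val alpha) r.-1.

(* Main.v *)
Require Import Defs.
From HB Require Import structures.
From mathcomp Require Import all_boot all_order all_algebra.
From mathcomp Require Import reals.
From mathcomp Require Import zify.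

Set Implicit Arguments.
Unset Strict Implicit.
Unset Printing Implicit Defensive.

Import GRing.Theory.
Local Open Scope ring_scope.

(** A path from [i] to [j] is nondecreasing with unit steps, so it is determined
    by the times at which it rises: for each height [s] with [i <= s < j] there
    is exactly one time [c s] at which it goes from [s] to [s.+1].  These times
    increase strictly with [s], and the condition on rise edges says exactly
    [c s <= s].  Listing them from the top height down, as
    [alpha_r = c (j - r)], turns these properties into the definition of
    [QSD j i], and the weight of the path becomes the product of the
    [- t (c s) s.+1], which is the claimed summand up to the sign [(-1)^(j-i)].

    The two directions of the bijection are [times_of] and [path_of], the
    latter recovering the height at time [k] as [i] plus the number of rise
    times below [k].  That they are inverse to each other rests on two Galois
    connections: [k <= c s] iff the height at time [k] is at most [s]
    ([leq_rise_time]), and, for a strictly decreasing sequence, the entry at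
    position [r] is below [k] iff at least [size - r] entries are
    ([sorted_gtn_nth_lt]). *)

(** * Rise times of a unit-step sequence *)

Definition rise_time (n : nat) (f : nat -> nat) (s : nat) : nat :=
  find (fun k => (s < f k.+1)%N) (iota 0 n).

Section RiseTimes.
Variables (n : nat) (f : nat -> nat).
Hypothesis f_step : forall k, (k < n)%N -> Ustep k (f k) (f k.+1).
Local Notation c := (rise_time n f).

Lemma Ustep_cases k : (k < n)%N ->
  f k.+1 = f k \/ f k.+1 = (f k).+1 /\ (k <= f k)%N.
Proof.
move=> /f_step /andP[/orP[/eqP-> _|/eqP->]]; first by left.
by rewrite eqxx /=; right.
Qed.

Lemma unit_step_mono k l : (k <= l)%N -> (l <= n)%N -> (f k <= f l)%N.
Proof.
elim: l => [|l IHl]; first by rewrite leqn0 => /eqP->.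
rewrite leq_eqVlt => /orP[/eqP-> //|kl ln].
by have := IHl kl (ltnW ln); case: (Ustep_cases ln) => [->|[-> _]] // /leqW.
Qed.

(** Monotonicity makes the first time of passing above [s] a threshold: [f]
    is at most [s] up to that time and above [s] after it. *)
Lemma leq_rise_time k s : (f 0 <= s)%N -> (k <= n)%N ->
  (k <= c s)%N = (f k <= s)%N.
Proof.
move=> f0s kn; apply/idP/idP.
  case: k kn => // k kn kc; have := before_find 0%N kc.
  by rewrite nth_iota // add0n => /negbT; rewrite -leqNgt.
move=> fks; rewrite leqNgt; apply/negP => ck.
have cn : (c s < n)%N by apply: leq_trans ck kn.
have := cn; rewrite -{2}(size_iota 0 n) -has_find => /(nth_find 0%N).
rewrite nth_iota // add0n => sf.
by have := unit_step_mono ck kn; rewrite -/(c s) in sf *; lia.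
Qed.

Lemma rise_timeP s : (f 0 <= s < f n)%N ->
  [/\ (c s < n)%N, f (c s) = s, f (c s).+1 = s.+1 & (c s <= s)%N].
Proof.
case/andP=> f0s sfn.
have cn : (c s < n)%N.
  by rewrite ltnNge (leq_rise_time f0s (leqnn n)) -ltnNge.
have := leq_rise_time f0s (ltnW cn); rewrite leqnn => /esym le1.
have := leq_rise_time f0s cn; rewrite ltnn => /esym/negbT; rewrite -ltnNge => lt1.
by case: (Ustep_cases cn) => [e|[e le]]; split=> //; lia.
Qed.

Lemma rise_time_step k : (k < n)%N -> f k.+1 = (f k).+1 -> c (f k) = k.
Proof.
move=> kn fk; have f0k := unit_step_mono (leq0n k) (ltnW kn).
have := leq_rise_time f0k (ltnW kn); have := leq_rise_time f0k kn.
by rewrite fk ltnn leqnn; lia.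
Qed.

Lemma rise_time_ltS s : (f 0 <= s)%N -> (s.+1 < f n)%N -> (c s < c s.+1)%N.
Proof.
move=> f0s sfn; have /rise_timeP[cn _ e _] : (f 0 <= s < f n)%N by lia.
by rewrite leq_rise_time ?e //; lia.
Qed.

(** Only the rise edges contribute, and they can be indexed by the height they
    leave instead of by time. *)
Lemma prod_edges_by_height (R : realType) (t : nat -> nat -> R) m :
  (m <= n)%N ->
  \prod_(k < m) Uinv_edge t k (f k) (f k.+1)
    = \prod_(f 0 <= s < f m) - t (c s) s.+1.
Proof.
elim: m => [|m IHm] mn; first by rewrite big_ord0 big_geq.
rewrite big_ord_recr /= IHm ?(ltnW mn) // /Uinv_edge.
case: (Ustep_cases mn) => [->|[e _]]; first by rewrite eqxx mulr1.
rewrite e gtn_eqF // big_nat_recr ?unit_step_mono ?(ltnW mn) //=.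
by rewrite rise_time_step.
Qed.

End RiseTimes.

(** * Counting in strictly decreasing sequences *)

(** The entries below [k] form a suffix of a decreasing sequence, so their
    number tells which positions they occupy. *)
Lemma sorted_gtn_nth_lt (s : seq nat) k r : sorted gtn s -> (r < size s)%N ->
  (nth 0%N s r < k)%N = (size s - r <= count (fun x => x < k)%N s)%N.
Proof.
elim: s r => // x s IHs r /= xs.
have /allP lt_x : all (gtn x) s by apply: order_path_min xs => a b d /=; lia.
have cs : (x < k)%N -> count (fun y => y < k)%N s = size s.
  by move=> xk; apply/eqP; rewrite -all_count; apply/allP => y /lt_x /=; lia.
have := count_size (fun y => y < k)%N s.
case: r => [|r] /=; first by case: ltnP cs => [_ -> //|_ _]; lia.
rewrite ltnS => le rs; rewrite IHs ?(path_sorted xs) // subSS.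
by case: ltnP cs => [_ ->|_ _] //; lia.
Qed.

Lemma count_ltS (s : seq nat) k : uniq s ->
  count (fun x => x < k.+1)%N s = (count (fun x => x < k)%N s + (k \in s))%N.
Proof.
move=> us; rewrite -(count_uniq_mem _ us) -count_predUI.
rewrite (@eq_count _ (predI _ _) pred0) ?count_pred0 ?addn0; last first.
  by move=> x /=; lia.
by apply: eq_count => x /=; lia.
Qed.

(** The values [b + m - r.+1] are the heights of the interval [b, b + m),
    enumerated from the top as in [QSD]. *)
Lemma count_below_iota b m d : (b <= d <= b + m)%N ->
  count (fun r => b + m - r.+1 < d)%N (iota 0 m) = (d - b)%N.
Proof.
elim: m => [|m IHm] bd /=; first by lia.
rewrite -[1%N]addn0 iotaDl count_map.
rewrite (@eq_count _ _ (fun r => b + m - r.+1 < d)%N); last by move=> r /=; lia.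
case: (leqP d (b + m)) => dm; first by rewrite IHm; lia.
have -> : d = (b + m).+1 by lia.
rewrite (@eq_in_count _ _ predT) ?count_predT ?size_iota; first by lia.
by move=> r; rewrite mem_iota /=; lia.
Qed.

(** * Paths and sequences in QSD *)

Section Bijection.
Variables (n : nat) (i j : 'I_n.+1).

Definition height (y : {ffun 'I_n.+1 -> 'I_n.+1}) (k : nat) : nat := y (inord k).

Lemma heightE y (k : 'I_n.+1) : height y k = y k.
Proof. by rewrite /height inord_val. Qed.

Lemma UpathsP (y : {ffun 'I_n.+1 -> 'I_n.+1}) :
  reflect [/\ height y 0 = i, height y n = j &
      forall k, (k < n)%N -> Ustep k (height y k) (height y k.+1)]
    (y \in Upaths i j).
Proof.
have e0 : height y 0 = y ord0 by rewrite -heightE.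
have en : height y n = y ord_max by rewrite -heightE.
have ek (k : 'I_n) : height y k = y (widen_ord (leqnSn n) k) by rewrite -heightE.
have eS (k : 'I_n) : height y k.+1 = y (lift ord0 k).
  by rewrite -heightE lift0.
rewrite inE; apply: (iffP and3P) => [[/eqP y0 /eqP yn /forallP ys]|[y0 yn ys]].
  split=> [||k kn]; rewrite ?e0 ?en ?y0 ?yn //.
  by have := ys (Ordinal kn); rewrite -ek -eS.
split; first by apply/eqP/val_inj; rewrite /= -e0.
  by apply/eqP/val_inj; rewrite /= -en.
by apply/forallP => k; rewrite -ek -eS ys.
Qed.

Lemma path_weightE (R : realType) (w : nat -> nat -> nat -> R) y :
  path_weight w y = \prod_(k < n) w k (height y k) (height y k.+1).
Proof.
apply: eq_bigr => k _; congr (w _ _ _); first by rewrite -heightE.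
by rewrite -heightE lift0.
Qed.

(** Position [r] holds the time of the rise leaving height [j - r.+1].  On
    paths this time lies below [j]; elsewhere the default value is the position
    itself, whose existence is what shows that ['I_j] is inhabited. *)
Definition times_of (y : {ffun 'I_n.+1 -> 'I_n.+1}) : (j - i).-tuple 'I_j :=
  [tuple insubd (widen_ord (leq_subr i j) r) (rise_time n (height y) (j - r.+1))
  | r < j - i].

Definition path_of (alpha : (j - i).-tuple 'I_j) : {ffun 'I_n.+1 -> 'I_n.+1} :=
  [ffun k : 'I_n.+1 => inord (i + count (fun x => x < k)%N (map val alpha))].

Lemma val_times_of y : y \in Upaths i j ->
  map val (times_of y)
    = [seq rise_time n (height y) (j - r.+1) | r <- iota 0 (j - i)].
Proof.
case/UpathsP=> y0 yn ys; rewrite -val_enum_ord -!map_comp.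
apply: eq_map => r /=; rewrite insubdK //.
have rj := ltn_ord r.
have /(rise_timeP ys)[_ _ _] : (height y 0 <= j - r.+1 < height y n)%N.
  by rewrite y0 yn; lia.
by rewrite unfold_in; lia.
Qed.

Lemma Upaths_leq y : y \in Upaths i j -> (i <= j)%N.
Proof. by case/UpathsP=> <- <- ys; apply: (unit_step_mono ys). Qed.

Lemma times_of_QSD y : y \in Upaths i j -> times_of y \in QSD j i.
Proof.
move=> yP; have ij := Upaths_leq yP; have valE := val_times_of yP.
have nthE (r : nat) : (r < j - i)%N ->
  nth 0%N (map val (times_of y)) r = rise_time n (height y) (j - r.+1).
  by move=> rj; rewrite valE (nth_map 0%N) ?size_iota // nth_iota.
case/UpathsP: (yP) => y0 yn ys; rewrite inE ij andTb; apply/andP; split.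
  apply/(sortedP 0%N) => r; rewrite size_map size_tuple => rj.
  rewrite !nthE ?(ltnW rj) // (_ : j - r.+1 = (j - r.+2).+1)%N; last by lia.
  by apply: (rise_time_ltS ys); rewrite ?y0 ?yn; lia.
apply/forallP => r; have rj := ltn_ord r.
have r0 : 'I_j by apply: (widen_ord (leq_subr i j) r).
rewrite (tnth_nth r0) -(nth_map r0 0%N val) ?size_tuple // nthE //.
have /(rise_timeP ys)[] // : (height y 0 <= j - r.+1 < height y n)%N.
by rewrite y0 yn; lia.
Qed.

Lemma times_ofK y : y \in Upaths i j -> path_of (times_of y) = y.
Proof.
move=> yP; have ij := Upaths_leq yP; case/UpathsP: (yP) => y0 yn ys.
apply/ffunP => k; rewrite ffunE val_times_of // count_map.
have kn : (k <= n)%N by rewrite -ltnS.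
have ik := unit_step_mono ys (leq0n k) kn.
have kj := unit_step_mono ys kn (leqnn n).
rewrite (@eq_in_count _ _ (fun r => i + (j - i) - r.+1 < height y k)%N).
  rewrite count_below_iota; last by lia.
  by rewrite -y0 subnKC // heightE inord_val.
move=> r; rewrite mem_iota /= => rj.
by rewrite ltnNge (leq_rise_time ys) ?y0; lia.
Qed.

Lemma height_path_of alpha k : (k <= n)%N ->
  height (path_of alpha) k = (i + count (fun x => x < k)%N (map val alpha))%N.
Proof.
move=> kn; rewrite /height ffunE inordK; last first.
  rewrite inordK //.
  have := count_size (fun x => x < k)%N (map val alpha).
  by rewrite size_map size_tuple; have := ltn_ord i; have := ltn_ord j; lia.
by rewrite inordK.
Qed.

Lemma QSDP alpha : alpha \in QSD j i ->
  [/\ (i <= j)%N, sorted gtn (map val alpha), uniq (map val alpha) &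
    forall r, (r < j - i)%N -> (nth 0%N (map val alpha) r <= j - r.+1)%N].
Proof.
rewrite inE => /and3P[ij so /forallP bd]; split=> //.
  by apply: sorted_uniq so => [a b d /=|a /=]; lia.
move=> r rj; have r0 : 'I_j by apply: (widen_ord (leq_subr i j) (Ordinal rj)).
rewrite (nth_map r0) ?size_tuple //.
by have := bd (Ordinal rj); rewrite (tnth_nth r0).
Qed.

Lemma path_of_Upaths alpha : alpha \in QSD j i -> path_of alpha \in Upaths i j.
Proof.
move=> aQ; have [ij so us bd] := QSDP aQ.
have sz : size (map val alpha) = (j - i)%N by rewrite size_map size_tuple.
have jn := ltn_ord j.
apply/UpathsP; split=> [||k kn].
- by rewrite height_path_of // (@eq_count _ _ pred0) ?count_pred0 ?addn0.
- rewrite height_path_of // (@eq_in_count _ _ predT) ?count_predT ?sz; first lia.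
  by move=> x /mapP[u _ ->] /=; have := ltn_ord u; lia.
rewrite !height_path_of ?(ltnW kn) // (count_ltS _ us) /Ustep.
case: (boolP (k \in _)) => [ka|_]; last by rewrite addn0 eqxx /= ltn_eqF.
(* The entry [k] sits at the position [r] for which exactly [j - i - r.+1]
   entries are below [k], so the bound [k <= j - r.+1] is [k <= height]. *)
rewrite addn1 addnS eqxx orbT implyTb andTb.
have rj : (index k (map val alpha) < j - i)%N.
  by have := ka; rewrite -index_mem sz.
have := bd _ rj; rewrite nth_index // => kr.
have := @sorted_gtn_nth_lt _ k.+1 _ so; move/(_ (index k (map val alpha))).
rewrite sz nth_index // ltnSn count_ltS // ka => /(_ rj)/esym.
by move: (count _ _) (index _ _) kr rj => u r; lia.
Qed.

Lemma path_ofK alpha : alpha \in QSD j i -> times_of (path_of alpha) = alpha.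
Proof.
move=> aQ; have [ij so us bd] := QSDP aQ; have pU := path_of_Upaths aQ.
have sz : size (map val alpha) = (j - i)%N by rewrite size_map size_tuple.
apply: val_inj; apply: (inj_map val_inj).
rewrite val_times_of //; apply: (@eq_from_nth _ 0%N).
  by rewrite sz size_map size_iota.
rewrite size_map size_iota => r rj.
rewrite (nth_map 0%N) ?size_iota // nth_iota // add0n.
case/UpathsP: (pU) => p0 pn ps; have jn := ltn_ord j.
(* Both sides are the threshold of the same condition on [k]. *)
have thr k : (k <= n)%N ->
  (k <= rise_time n (height (path_of alpha)) (j - r.+1))%N
    = (k <= nth 0%N (map val alpha) r)%N.
  move=> kn; rewrite (leq_rise_time ps) ?p0 //; last by lia.
  rewrite height_path_of // [RHS]leqNgt sorted_gtn_nth_lt ?sz //.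
  by move: (count _ _) => u; lia.
have /(rise_timeP ps)[cn _ _ _] :
  (height (path_of alpha) 0 <= j - r.+1 < height (path_of alpha) n)%N.
  by rewrite p0 pn; lia.
have an : (nth 0%N (map val alpha) r <= n)%N.
  by apply: leq_trans (bd _ rj) _; lia.
by apply/eqP; rewrite eqn_leq -thr ?(ltnW cn) // leqnn thr // leqnn.
Qed.

Lemma path_weight_times (R : realType) (t : nat -> nat -> R) y :
  y \in Upaths i j ->
  path_weight (Uinv_edge t) y
    = (-1) ^+ (j - i) *
      \prod_(i <= s < j) t (entry (times_of y) (j - s)%N) s.+1.
Proof.
move=> yP; case/UpathsP: (yP) => y0 yn ys.
rewrite path_weightE (prod_edges_by_height ys) // y0 yn.
rewrite -prodr_const_nat -big_split /=; apply: eq_big_nat => s /andP[is_ sj].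
rewrite mulN1r /entry val_times_of // (nth_map 0%N) ?size_iota; last by lia.
rewrite nth_iota; last by lia.
by do 3!f_equal; lia.
Qed.

End Bijection.

Theorem theorem4p4 (R : realType) (t : nat -> nat -> R) (n : nat)
    (hn : (1 <= n)%N) (i j : 'I_n.+1) :
  Uinv t n i j =
    (-1) ^ (i%:Z - j%:Z) *
    \sum_(alpha in QSD j i) \prod_(i <= s < j) t (entry alpha (j - s)%N) s.+1.
Proof.
rewrite mxE (reindex_onto (@path_of n i j) (@times_of n i j)); last first.
  exact: times_ofK.
rewrite big_distrr; apply: eq_big => [alpha|alpha /andP[pU /eqP aK]].
  apply/andP/idP => [[pU /eqP <-]|aQ]; first exact: times_of_QSD.
  by rewrite path_of_Upaths // path_ofK.
rewrite (path_weight_times t pU) aK; congr (_ * _).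
have ij := Upaths_leq pU.
(* The exponent [i - j] is a nonpositive integer, and [-1] is its own inverse. *)
have -> : (i%:Z - j%:Z = - (j - i)%N%:Z)%R by lia.
by rewrite -invr_expz -exprnP -exprVn invrN1.
Qed.
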